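(* Let $\mathcal{A}$ be an abelian length category with $\mathrm{rk}(K_0(\mathcal{A}))=n$. Then every red path $\gamma:[0,1]\to\mathbb{R}^n$ induces a stability function $\phi_\gamma:\mathrm{Obj}^*(\mathcal{A})\to[0,1]$ defined by $\phi_\gamma(M)=t_M$, where $t_M$ is the unique element of $[0,1]$ such that $\langle\gamma(t_M),[M]\rangle=0$. Moreover, a non-zero object $M$ of $\mathcal{A}$ is $\phi_\gamma$-semistable if and only if $M$ is $\gamma(t_M)$-semistable.
   Context: $\mathcal{A}$ is essentially small, and each object has a finite filtration with simple quotients. It has $n$ simple objects up to isomorphism; $K_0(\mathcal{A})$ is identified with $\mathbb{Z}^n$ via the basis of classes of simple objects, $[M]\in\mathbb{Z}^n\subset\mathbb{R}^n$ denotes the class of $M$, and $\langle-,-\rangle$ is the standard inner product on $\mathbb{R}^n$. $\mathrm{Obj}^*(\mathcal{A})$ is the class of non-zero objects. A red path is a continuous function $\gamma:[0,1]\to\mathbb{R}^n$ with $\gamma(0)=(1,\dots,1)$, $\gamma(1)=(-1,\dots,-1)$, and such that for every non-zero object $M$ there is a unique $t_M\in[0,1]$ with $\langle\gamma(t_M),[M]\rangle=0$. For a totally ordered set $\mathcal{P}$, a function $\phi:\mathrm{Obj}^*(\mathcal{A})\to\mathcal{P}$, constant on isomorphism classes, is a stability function if for each short exact sequence $0\to L\to M\to N\to 0$ of non-zero objects exactly one of the following holds: $\phi(L)<\phi(M)<\phi(N)$, or $\phi(L)>\phi(M)>\phi(N)$, or $\phi(L)=\phi(M)=\phi(N)$.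 A non-zero object $M$ is $\phi$-semistable if every subobject $L\subset M$ with $0\ne L\neq M$ satisfies $\phi(L)\leq\phi(M)$. For $\theta\in\mathbb{R}^n$, an object $M$ is $\theta$-semistable (in the sense of King) if $\langle\theta,[M]\rangle=0$ and $\langle\theta,[L]\rangle\leq 0$ for every proper subobject $L$ of $M$. *)

(* Defs.v *)
From HB Require Import structures.
From mathcomp Require Import all_boot all_order all_algebra.
From mathcomp Require Import boolp classical_sets reals interval_inference.
From mathcomp Require Import topology normedtype.
From mathcomp.multinomials Require Import freeg.

Set Implicit Arguments.
Unset Strict Implicit.
Unset Printing Implicit Defensive.

Import Order.TTheory GRing.Theory Num.Theory.
Import numFieldNormedType.Exports.

Local Open Scope classical_set_scope.
Local Open Scope ring_scope.

(** * Abelian categories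

    The objects form a [Type] and the morphisms between two objects a
    [zmodType]; since every [Type] is small relative to some larger universe,
    "essentially small" needs no separate hypothesis. *)

Record preadditive := Preadditive {
  object :> Type;
  mor : object -> object -> zmodType;
  idm : forall X, mor X X;
  mcomp : forall X Y Z, mor Y Z -> mor X Y -> mor X Z;
  mcompA : forall W X Y Z (h : mor Y Z) (g : mor X Y) (f : mor W X),
    mcomp h (mcomp g f) = mcomp (mcomp h g) f;
  mcomp1m : forall X Y (f : mor X Y), mcomp (idm Y) f = f;
  mcompm1 : forall X Y (f : mor X Y), mcomp f (idm X) = f;
  mcompDl : forall X Y Z (g h : mor Y Z) (f : mor X Y),
    mcomp (g + h) f = mcomp g f + mcomp h f;
  mcompDr : forall X Y Z (h : mor Y Z) (f g : mor X Y),
    mcomp h (f + g) = mcomp h f + mcomp h g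
}.

Arguments idm {p} X.

Declare Scope cat_scope.
Notation "g \oc f" := (mcomp g f) (at level 40, left associativity) : cat_scope.
Local Open Scope cat_scope.

Section Morphisms.
Variable C : preadditive.
Implicit Types X Y Z K Q L M N : C.

Definition monic X Y (f : mor X Y) : Prop :=
  forall W (g h : mor W X), f \oc g = f \oc h -> g = h.

Definition epic X Y (f : mor X Y) : Prop :=
  forall Z (g h : mor Y Z), g \oc f = h \oc f -> g = h.

Definition is_iso X Y (f : mor X Y) : Prop :=
  exists g : mor Y X, g \oc f = idm X /\ f \oc g = idm Y.

Definition isomorphic X Y : Prop := exists f : mor X Y, is_iso f.

(* Initial and terminal: each group of morphisms contains 0, so having a
   single element means that every element is 0. *)
Definition zero_object X : Prop :=
  (forall Y (f : mor X Y), f = 0) /\ (forall Y (f : mor Y X), f = 0).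

Definition is_kernel X Y (f : mor X Y) K (k : mor K X) : Prop :=
  f \oc k = 0 /\
  forall W (g : mor W X), f \oc g = 0 -> exists! u : mor W K, k \oc u = g.

Definition is_cokernel X Y (f : mor X Y) Q (q : mor Y Q) : Prop :=
  q \oc f = 0 /\
  forall Z (g : mor Y Z), g \oc f = 0 -> exists! u : mor Q Z, u \oc q = g.

Definition is_biproduct X Y Z
    (i1 : mor X Z) (i2 : mor Y Z) (p1 : mor Z X) (p2 : mor Z Y) : Prop :=
  [/\ p1 \oc i1 = idm X, p2 \oc i2 = idm Y, p1 \oc i2 = 0, p2 \oc i1 = 0
    & i1 \oc p1 + i2 \oc p2 = idm Z].

(* 0 -> L -f-> M -g-> N -> 0 *)
Definition short_exact L M N (f : mor L M) (g : mor M N) : Prop :=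
  is_kernel g f /\ is_cokernel f g.

(* Subobjects of M are represented by monomorphisms into M; the subobject
   given by a monomorphism is M itself exactly when the latter is an
   isomorphism. *)
Definition proper_subobject L M (f : mor L M) : Prop := monic f /\ ~ is_iso f.

Definition simple_object X : Prop :=
  ~ zero_object X /\
  forall L (f : mor L X), proper_subobject f -> zero_object L.

(* M has a filtration 0 = M_0 < M_1 < ... < M_k = M with simple quotients. *)
Inductive has_filtration : C -> Prop :=
| filtration_zero M : zero_object M -> has_filtration M
| filtration_step L M S (f : mor L M) (g : mor M S) :
    short_exact f g -> has_filtration L -> simple_object S -> has_filtration M.

Definition is_abelian : Prop :=
  [/\ exists X, zero_object X,
      forall X Y, exists Z (i1 : mor X Z) (i2 : mor Y Z)
        (p1 : mor Z X) (p2 : mor Z Y), is_biproduct i1 i2 p1 p2,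
      forall X Y (f : mor X Y),
        (exists K (k : mor K X), is_kernel f k) /\
        (exists Q (q : mor Y Q), is_cokernel f q),
      forall X Y (f : mor X Y), monic f ->
        exists Z (g : mor Y Z), is_kernel g f
    & forall X Y (f : mor X Y), epic f ->
        exists W (g : mor W X), is_cokernel g f].

Definition is_length_category : Prop := forall M, has_filtration M.

Definition simple_representatives n (S : 'I_n -> C) : Prop :=
  [/\ forall i, simple_object (S i),
      forall i j, isomorphic (S i) (S j) -> i = j
    & forall X, simple_object X -> exists i, isomorphic X (S i)].

End Morphisms.

(** * The Grothendieck group *)

Section GrothendieckGroup.
Variable C : preadditive.

(* The subgroup of the free abelian group on the objects that is generated by
   the elements [M] - [L] - [N]. Generators for objects rather than for
   isomorphism classes give the same quotient: L = 0 yields [M] = [N]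
   whenever M and N are isomorphic. *)
Inductive K0_relation : {freeg {classic C}} -> Prop :=
| K0_relation_ses (L M N : C) (f : mor L M) (g : mor M N) :
    short_exact f g ->
    K0_relation (<< (M : {classic C}) >> - << (L : {classic C}) >>
                 - << (N : {classic C}) >>)
| K0_relation0 : K0_relation 0
| K0_relationB x y : K0_relation x -> K0_relation y -> K0_relation (x - y).

Definition K0_relations : {pred {freeg {classic C}}} :=
  fun x => `[< K0_relation x >].

Fact K0_relations_zmod_closed : zmod_closed K0_relations.
Proof.
split; first by apply/asboolP; exact: K0_relation0.
by move=> x y /asboolP ? /asboolP ?; apply/asboolP; exact: K0_relationB.
Qed.

HB.instance Definition _ :=
  GRing.isZmodClosed.Build {freeg {classic C}} K0_relations
    K0_relations_zmod_closed.

Definition K0 : zmodType := Quotient.quot K0_relations.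

Definition K0_class (M : C) : K0 := (\pi_K0 << (M : {classic C}) >>)%qT.

End GrothendieckGroup.

(** * Stability functions *)

Section Stability.
Variable C : preadditive.

Record nzobject := NzObject {
  nzobject_val :> C;
  nzobjectP : ~ zero_object nzobject_val
}.

Definition exactly_one3 (P Q R : Prop) : Prop :=
  [/\ P \/ Q \/ R, ~ (P /\ Q), ~ (P /\ R) & ~ (Q /\ R)].

Definition stability_function d (P : orderType d) (phi : nzobject -> P) :
    Prop :=
  (forall M N : nzobject, isomorphic M N -> phi M = phi N) /\
  (forall (L M N : nzobject) (f : mor L M) (g : mor M N), short_exact f g ->
    exactly_one3 ((phi L < phi M)%O /\ (phi M < phi N)%O)
                 ((phi L > phi M)%O /\ (phi M > phi N)%O)
                 (phi L = phi M /\ phi M = phi N)).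

Definition semistable d (P : orderType d) (phi : nzobject -> P)
    (M : nzobject) : Prop :=
  forall (L : nzobject) (f : mor L M), proper_subobject f ->
    (phi L <= phi M)%O.

End Stability.

(** * Red paths *)

Definition dotp (R : realType) n (u v : 'rV[R]_n) : R :=
  \sum_(i < n) u 0 i * v 0 i.

Section RedPaths.
Variables (R : realType) (n : nat) (C : preadditive).
Variable iota : {additive K0 C -> 'rV[int]_n}.

Definition class_vector (M : C) : 'rV[R]_n :=
  map_mx intr (iota (K0_class M)).

Definition king_semistable (theta : 'rV[R]_n) (M : C) : Prop :=
  dotp theta (class_vector M) = 0 /\
  forall (L : C) (f : mor L M), proper_subobject f ->
    dotp theta (class_vector L) <= 0.

(* The values of [red_fun] outside [0, 1] are irrelevant. *)
Record red_path := RedPath {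
  red_fun :> R -> 'rV[R]_n;
  red_continuous : {within `[0, 1], continuous red_fun};
  red_start : red_fun 0 = const_mx 1;
  red_end : red_fun 1 = const_mx (-1);
  red_crossing : forall M : C, ~ zero_object M ->
    exists! t : {i01 R}, dotp (red_fun t%:num) (class_vector M) = 0
}.

Definition phi_red (gamma : red_path) (M : nzobject C) : {i01 R} :=
  projT1 (cid (red_crossing gamma (@nzobjectP C M))).

End RedPaths.

(* Main.v *)
(** For a non-zero object M, the function t |-> <gamma(t), [M]> is positive at
    0 and negative at 1, because the coordinates of [M] sum to the length of M.
    Having a single zero t_M it is positive before t_M and negative after it,
    so that t_L is compared with t_M by the sign of <gamma(t_M), [L]>. Since
    <gamma(t_M), [L]> + <gamma(t_M), [N]> = <gamma(t_M), [M]> = 0 for a short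
    exact sequence 0 -> L -> M -> N -> 0, the values t_L and t_N lie on opposite
    sides of t_M or both are equal to it. *)
Require Import Defs.
From mathcomp Require Import all_boot all_order all_algebra.
From mathcomp Require Import boolp classical_sets reals interval_inference.
From mathcomp Require Import topology normedtype.
Set Implicit Arguments.
Unset Strict Implicit.
Unset Printing Implicit Defensive.
Import Order.TTheory GRing.Theory Num.Theory.
Import numFieldNormedType.Exports.
Local Open Scope ring_scope.

Section PreadditiveCategory.
Variable C : preadditive.
Implicit Types X Y Z L M N : C.

Lemma mcomp0 {X Y Z} (g : mor Y Z) : mcomp g (0 : mor X Y) = 0.
Proof. by apply: (addrI (mcomp g (0 : mor X Y))); rewrite -mcompDr !addr0. Qed.

(** The relations of [K0] come only from short exact sequences, so an isomorphism must be turned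
    into one, with zero kernel, before it can identify two classes. *)
Lemma zero_short_exact_iso Z X Y (f : mor X Y) :
  zero_object Z -> is_iso f -> short_exact (0 : mor Z X) f.
Proof.
move=> [Zout Zin] [g [gf fg]]; split; split; rewrite ?mcomp0 //.
- move=> W h fh0; exists 0; split; last by move=> u _; rewrite (Zin _ u).
  by rewrite mcomp0 -[h]mcomp1m -gf -mcompA fh0 mcomp0.
- move=> W h _; exists (mcomp h g); split; first by rewrite -mcompA gf mcompm1.
  by move=> u <-; rewrite -mcompA fg mcompm1.
Qed.

Lemma K0_class_short_exact L M N (f : mor L M) (g : mor M N) :
  short_exact f g -> K0_class M = K0_class L + K0_class N.
Proof.
move=> fg; rewrite /K0_class -[RHS]Quotient.pi_add; apply/eqP.
rewrite -Quotient.idealrBE opprD addrA; apply/asboolP.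
exact: K0_relation_ses fg.
Qed.

Lemma K0_class_zero X : zero_object X -> K0_class X = 0.
Proof.
move=> X0.
have idX : is_iso (idm X) by exists (idm X); rewrite mcomp1m.
(* The sequence 0 -> X -> X -> X -> 0 is exact when X is zero, so [X] = [X] + [X]. *)
have := K0_class_short_exact (zero_short_exact_iso X0 idX).
by rewrite -[LHS]addr0 => /addrI.
Qed.

Hypothesis has_zero : exists Z : C, zero_object Z.

Lemma K0_class_iso X Y : isomorphic X Y -> K0_class X = K0_class Y.
Proof.
case: has_zero => Z Z0 [f f_iso].
rewrite (K0_class_short_exact (zero_short_exact_iso Z0 f_iso)).
by rewrite (K0_class_zero Z0) add0r.
Qed.

End PreadditiveCategory.

Section ClassVector.
Variables (R : realType) (n : nat) (A : preadditive).
Variable iota : {additive K0 A -> 'rV[int]_n}.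
Hypothesis has_zero : exists Z : A, zero_object Z.

Lemma dotpDr (u v w : 'rV[R]_n) : dotp u (v + w) = dotp u v + dotp u w.
Proof. by rewrite -big_split; apply: eq_bigr => i _; rewrite mxE mulrDr. Qed.

Lemma dotpNl (u v : 'rV[R]_n) : dotp (- u) v = - dotp u v.
Proof. by rewrite -sumrN; apply: eq_bigr => i _; rewrite mxE mulNr. Qed.

Lemma dotp0 (u : 'rV[R]_n) : dotp u 0 = 0.
Proof. by apply: big1 => i _; rewrite mxE mulr0. Qed.

Lemma class_vector_short_exact L M N (f : mor L M) (g : mor M N) :
  short_exact f g ->
  class_vector R iota M = class_vector R iota L + class_vector R iota N.
Proof. by move=> fg; rewrite /class_vector (K0_class_short_exact fg) !raddfD. Qed.

Lemma class_vector_zero M : zero_object M -> class_vector R iota M = 0.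
Proof. by move=> M0; rewrite /class_vector K0_class_zero // !raddf0. Qed.

Lemma dotp1_simple (S : 'I_n -> A) X :
  simple_representatives S ->
  (forall i, iota (K0_class (S i)) = delta_mx 0 i) ->
  simple_object X -> dotp (const_mx 1) (class_vector R iota X) = 1.
Proof.
move=> [_ _ S_all] iotaS /S_all [i XSi].
rewrite /class_vector (K0_class_iso has_zero XSi) iotaS /dotp (bigD1 i) //= big1.
  by rewrite !mxE !eqxx mul1r addr0.
by move=> j /negPf ji; rewrite !mxE ji andbF mulr0.
Qed.

(** Pairing with (1,...,1) counts the simple quotients of a filtration: each step adds exactly 1,
    and a non-zero object needs at least one step. *)
Lemma dotp1_class_vector_gt0 (S : 'I_n -> A) M :
  simple_representatives S ->
  (forall i, iota (K0_class (S i)) = delta_mx 0 i) ->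
  has_filtration M -> ~ zero_object M ->
  0 < dotp (const_mx 1) (class_vector R iota M).
Proof.
move=> reprS iotaS filM nM0.
have ge0 : forall L, has_filtration L ->
    0 <= dotp (const_mx 1) (class_vector R iota L).
  move=> L; elim=> {L} [L L0|L N T f g fg _ IH sT].
    by rewrite class_vector_zero ?dotp0.
  rewrite (class_vector_short_exact fg) dotpDr (dotp1_simple reprS iotaS sT).
  by rewrite addr_ge0.
(* The subobject L of the last step may be zero, so it contributes only a nonnegative term;
   strictness comes from the simple quotient T. *)
case: filM nM0 => [L L0 //|L N T f g fg filL sT _].
rewrite (class_vector_short_exact fg) dotpDr (dotp1_simple reprS iotaS sT).
by rewrite ltr_wpDl // ge0.
Qed.

End ClassVector.

(** By the intermediate value theorem, a wrong sign at s < t would force a zero in [0, s], and a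
    wrong sign at s > t one in [s, 1]; neither interval contains t, the only possible zero. *)
Lemma unique_zero_sign (R : realType) (f : R -> R) (t : R) :
  {within `[0, 1], continuous f}%classic -> 0 < f 0 -> f 1 < 0 ->
  (forall s, s \in `[0, 1] -> f s = 0 -> s = t) ->
  forall s, s \in `[0, 1] -> (f s > 0) = (s < t) /\ (f s < 0) = (t < s).
Proof.
move=> f_cont f0 f1 t_uniq.
have before s : s \in `[0, 1] -> s < t -> 0 < f s.
  rewrite in_itv /= => /andP[s0 s1] st; rewrite ltNge; apply/negP => fs.
  have cts : {within `[0, s], continuous f}%classic.
    apply: continuous_subspaceW f_cont => x /=; rewrite !in_itv /= => /andP[-> xs].
    exact: le_trans xs s1.
  have [|c] := IVT s0 cts (v := 0); first by rewrite ge_min fs orbT le_max ltW.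
  rewrite in_itv /= => /andP[c0 cs] /t_uniq ct.
  by move: (le_lt_trans cs st); rewrite ct ?ltxx // in_itv /= c0 (le_trans cs).
have after s : s \in `[0, 1] -> t < s -> f s < 0.
  rewrite in_itv /= => /andP[s0 s1] ts; rewrite ltNge; apply/negP => fs.
  have cts : {within `[s, 1], continuous f}%classic.
    apply: continuous_subspaceW f_cont => x /=; rewrite !in_itv /= => /andP[sx ->].
    by rewrite (le_trans s0 sx).
  have [|c] := IVT s1 cts (v := 0).
    by rewrite ge_min (ltW f1) orbT le_max fs.
  rewrite in_itv /= => /andP[sc c1] /t_uniq ct.
  by move: (lt_le_trans ts sc); rewrite ct ?ltxx // in_itv /= c1 (le_trans s0).
(* That t is itself a zero is not assumed: the sign change over [0, 1] yields some zero, which must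
   be t. *)
have ft0 : f t = 0.
  have [|c c01 fc] := IVT ler01 f_cont (v := 0).
    by rewrite ge_min (ltW f1) orbT le_max ltW.
  by rewrite -(t_uniq c).
move=> s s01; case: (ltgtP s t) => [st|ts|->].
- by have fs := before _ s01 st; rewrite fs (lt_gtF fs).
- by have fs := after _ s01 ts; rewrite fs (lt_gtF fs).
- by rewrite ft0 ltxx.
Qed.

Lemma dotp_continuous (R : realType) n (v : 'rV[R]_n) :
  continuous (fun u => dotp u v).
Proof.
apply: continuous_big => [|i _ u]; first exact: add_continuous.
apply: continuousM; [exact: coord_continuous | exact: cst_continuous].
Qed.

Section RedPath.
Variables (R : realType) (n : nat) (A : preadditive).
Variable S : 'I_n -> A.
Variable iota : {additive K0 A -> 'rV[int]_n}.
Hypothesis has_zero : exists Z : A, zero_object Z.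
Hypothesis A_length : is_length_category A.
Hypothesis reprS : simple_representatives S.
Hypothesis iotaS : forall i, iota (K0_class (S i)) = delta_mx 0 i.
Variable gamma : red_path R iota.
Implicit Types L M : nzobject A.

Let phi := phi_red gamma.
Let f M (t : R) := dotp (gamma t) (class_vector R iota M).

Lemma phi_red_zero M : f M (phi M)%:num = 0.
Proof. by rewrite /f /phi /phi_red; case: cid => t []. Qed.

Lemma phi_red_unique M t : f M t%:num = 0 -> t = phi M.
Proof.
by rewrite /f /phi /phi_red; case: cid => s [? uniq] /= /uniq.
Qed.

(** The endpoints of the path give opposite non-zero signs, since gamma(1) = -gamma(0) and pairing
    with gamma(0) is positive on non-zero objects. *)
Lemma phi_red_sign M (t : {i01 R}) :
  (0 < f M t%:num) = (t < phi M) /\ (f M t%:num < 0) = (phi M < t).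
Proof.
have in01 (s : {i01 R}) : s%:num \in `[0, 1] by rewrite in_itv /= ge0 le1.
have f0 : 0 < f M 0.
  rewrite /f red_start; apply: dotp1_class_vector_gt0 reprS iotaS _ _ => //.
  exact: nzobjectP.
apply: unique_zero_sign => //.
- apply: (@within_continuous_comp _ _ _ _ gamma (fun u => dotp u _)).
    by move=> u _; exact: dotp_continuous.
  exact: red_continuous.
- move: f0; rewrite /f red_start red_end.
  have -> : const_mx (-1) = - const_mx 1 :> 'rV[R]_n.
    by apply/rowP=> i; rewrite !mxE.
  by rewrite dotpNl oppr_lt0.
- move=> s; rewrite in_itv /= => /andP[s0 s1] fs0.
  by have /= <- := @phi_red_unique M (Itv01 s0 s1) fs0.
Qed.

(** This is the bridge to King's condition: the function of L is evaluated at the crossing time of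
    M. *)
Lemma phi_red_le L M : (phi L <= phi M)%O = (f L (phi M)%:num <= 0).
Proof. by rewrite leNgt -(phi_red_sign L _).1 -leNgt. Qed.

Lemma phi_red_iso L M : isomorphic L M -> phi L = phi M.
Proof.
move=> LM; apply: phi_red_unique.
by rewrite /f /class_vector -(K0_class_iso has_zero LM); exact: phi_red_zero.
Qed.

Lemma phi_red_stability : stability_function phi.
Proof.
split; first exact: phi_red_iso.
move=> L M N g h gh.
have sum0 : f L (phi M)%:num + f N (phi M)%:num = 0.
  by rewrite -dotpDr -(class_vector_short_exact _ _ gh); exact: phi_red_zero.
have fN : f N (phi M)%:num = - f L (phi M)%:num.
  by apply/eqP; rewrite -addr_eq0 addrC sum0.
have [posL negL] := phi_red_sign L (phi M).
have [posN negN] := phi_red_sign N (phi M).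
(* The signs for N are those for L reversed, so t_M < t_N iff t_L < t_M, and t_N < t_M iff t_M <
   t_L. Comparing t_L with t_M then settles all three cases. *)
move: posN negN; rewrite fN oppr_gt0 oppr_lt0 negL posL => posN negN.
rewrite -posN -negN /exactly_one3; case: ltgtP posN negN => LM posN negN.
- split=> [|[_ []]|[_ [/eqP]]|[[]]] //; first by left.
  by rewrite (lt_eqF LM).
- split=> [|[[]]|[[]]|[_ [/eqP]]] //; first by right; left.
  by rewrite (gt_eqF LM).
- have MN : phi M = phi N by apply/le_anti; rewrite !leNgt -posN -negN.
  by split=> [|[[]]|[[]]|[[]]] //; right; right.
Qed.

Lemma phi_red_semistable M :
  semistable phi M <-> king_semistable iota (gamma (phi M)%:num) M.
Proof.
split=> [ssM|[_ ssM] L g g_proper]; last first.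
  by rewrite phi_red_le; exact: ssM g_proper.
split=> [|L g g_proper]; first exact: phi_red_zero.
(* King's condition also ranges over the zero subobject, on which [phi] is undefined; there the
   pairing is 0. *)
have [L0|nL0] := pselect (zero_object L).
  by rewrite class_vector_zero ?dotp0.
by have := ssM (NzObject nL0) g g_proper; rewrite phi_red_le.
Qed.

End RedPath.

Theorem theorem4p8 (R : realType) (n : nat) (A : preadditive)
    (A_abelian : is_abelian A)
    (A_length : is_length_category A)
    (S : 'I_n -> A)
    (S_simples : simple_representatives S)
    (iota : {additive K0 A -> 'rV[int]_n})
    (iota_bij : bijective iota)
    (iota_S : forall i : 'I_n, iota (K0_class (S i)) = delta_mx 0 i)
    (gamma : red_path R iota) :
  stability_function (phi_red gamma) /\
  (forall M : nzobject A,
     semistable (phi_red gamma) M <->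
     king_semistable iota (gamma (phi_red gamma M)%:num) M).
Proof.
have [has_zero _ _ _ _] := A_abelian.
split; first exact: phi_red_stability S_simples iota_S gamma.
by move=> M; exact: phi_red_semistable S_simples iota_S gamma M.
Qed.
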